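(* Let $X$ be a nonempty finite or countably infinite set, let $\Lambda\subseteq X$, and let $c\ge 0$ and $w\ge 0$ be (real-valued) vectors indexed by $X$ that are strictly positive on $\Lambda$. Consider the following conditions on a matrix $\alpha=(\alpha_{xy})_{x,y\in X}$ with nonnegative real entries: (a) $\sum_{k=0}^\infty c(I_\Lambda\alpha I_\Lambda)^kw<\infty$. (b) For all $h\colon X\to[0,1]$ with $\operatorname{supp}h=\Lambda$ such that $h\ge\epsilon\chi_\Lambda$ for some $\epsilon>0$, we have $\sum_{k=0}^\infty c(I_\Lambda\beta_hI_\Lambda)^kw<\infty$. (b$'$) There exists $h\colon X\to[0,1]$ with $\operatorname{supp}h=\Lambda$ such that $\sum_{k=0}^\infty c(I_\Lambda\beta_hI_\Lambda)^kw<\infty$. (c) For every finite sequence $f_1,\ldots,f_m$ of functions $X\to[0,1]$ with $\operatorname{supp}(f_i)\subseteq\Lambda$ such that $\sum_if_i\ge\epsilon\chi_\Lambda$ for some $\epsilon>0$, we have $\sum_{k=0}^\infty c(I_\Lambda\beta_{f_1}\cdots\beta_{f_m}I_\Lambda)^kw<\infty$. (c$'$) There exists a finite sequence $f_1,\ldots,f_m$ of functions $X\to[0,1]$ with $\operatorname{supp}(f_i)\subseteq\Lambda$ such that $\sum_{k=0}^\infty c(I_\Lambda\beta_{f_1}\cdots\beta_{f_m}I_\Lambda)^kw<\infty$. Then (a), (b), (b$'$) and (c) are all equivalent and imply (c$'$); and for matrices $\alpha$ satisfying the additional hypothesis that there exists a constant $C<\infty$ such that $I_\Lambda\alpha I_\Lambda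 w\le Cw$, all five conditions are equivalent.
   Context: $c$ is a row vector and $w$ a column vector; all products and sums of nonnegative quantities are computed in $[0,+\infty]$ with $0\cdot\infty=0$. For $f\colon X\to\mathbb R$, $I_f$ is the diagonal matrix $(I_f)_{xy}=f(x)\delta_{xy}$; $I_\Lambda=I_{\chi_\Lambda}$ with $\chi_\Lambda$ the indicator function of $\Lambda$. A $0$-th power of a matrix is the identity matrix. For $f\colon X\to[0,1]$ the cleaning operator is $\beta_f=I_{1-f}+I_f\alpha$. $\operatorname{supp}f=\{x\in X: f(x)\ne 0\}$. No subinvariance condition (such as $\alpha w\le w$) is assumed. *)

(* Defs.v *)
From mathcomp Require Import all_boot all_order all_algebra.
From mathcomp Require Import all_classical all_reals all_analysis.

Set Implicit Arguments.
Unset Strict Implicit.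
Unset Printing Implicit Defensive.

Import Order.TTheory GRing.Theory Num.Theory.

Local Open Scope classical_set_scope.
Local Open Scope ring_scope.
Local Open Scope ereal_scope.

(* Matrices indexed by X have entries in \bar R because products of real
   matrices may have infinite entries.  All entries considered are nonnegative,
   so \esum is the usual sum in [0, +oo]; 0 * +oo = 0 in \bar R. *)
Section InfiniteMatrices.
Context {R : realType} {X : countType}.
Implicit Types (A B : X -> X -> \bar R) (f c w : X -> R) (L : set X).

Definition imx_id : X -> X -> \bar R := fun x y => (x == y)%:R%:E.

Definition imx_diag f : X -> X -> \bar R := fun x y => (f x *+ (x == y))%:E.

Definition imx_of (a : X -> X -> R) : X -> X -> \bar R := fun x y => (a x y)%:E.

Definition imx_add A B : X -> X -> \bar R := fun x y => A x y + B x y.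

Definition imx_mul A B : X -> X -> \bar R :=
  fun x z => \esum_(y in [set: X]) (A x y * B y z).

Definition imx_exp A (k : nat) : X -> X -> \bar R := iter k (imx_mul A) imx_id.

Definition imx_mulv A w : X -> \bar R :=
  fun x => \esum_(y in [set: X]) (A x y * (w y)%:E).

Definition imx_form c A w : \bar R :=
  \esum_(x in [set: X]) ((c x)%:E * imx_mulv A w x).

Definition imx_restr L A : X -> X -> \bar R :=
  imx_mul (imx_diag \1_L) (imx_mul A (imx_diag \1_L)).

Definition cleaning (a : X -> X -> R) f : X -> X -> \bar R :=
  imx_add (imx_diag (fun x => 1 - f x)%R) (imx_mul (imx_diag f) (imx_of a)).

(* The noncommutative product in increasing order of i. *)
Definition cleaning_prod (a : X -> X -> R) (m : nat) (f : 'I_m -> X -> R) :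
    X -> X -> \bar R :=
  \big[imx_mul/imx_id]_(i < m) cleaning a (f i).

Definition summable_powers L c w A : Prop :=
  \sum_(0 <= k <oo) imx_form c (imx_exp (imx_restr L A) k) w < +oo.

Definition unit_valued f : Prop := forall x, (0 <= f x <= 1)%R.

Definition supp f : set X := [set x | f x != 0%R].

Definition cond_a L c w a : Prop := summable_powers L c w (imx_of a).

Definition cond_b L c w a : Prop :=
  forall h : X -> R, unit_valued h -> supp h = L ->
    (exists2 e : R, (0 < e)%R & forall x, (e * \1_L x <= h x)%R) ->
    summable_powers L c w (cleaning a h).

Definition cond_b' L c w a : Prop :=
  exists h : X -> R,
    [/\ unit_valued h, supp h = L & summable_powers L c w (cleaning a h)].

Definition cond_c L c w a : Prop :=
  forall (m : nat) (f : 'I_m -> X -> R), (0 < m)%N ->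
    (forall i, unit_valued (f i)) -> (forall i, supp (f i) `<=` L) ->
    (exists2 e : R, (0 < e)%R &
      forall x, (e * \1_L x <= \sum_(i < m) f i x)%R) ->
    summable_powers L c w (cleaning_prod a f).

Definition cond_c' L c w a : Prop :=
  exists (m : nat) (f : 'I_m -> X -> R),
    [/\ (0 < m)%N, forall i, unit_valued (f i), forall i, supp (f i) `<=` L &
        summable_powers L c w (cleaning_prod a f)].

End InfiniteMatrices.

(* Main.v *)
Require Import Defs.
From mathcomp Require Import all_boot all_order all_algebra.
From mathcomp Require Import all_classical all_reals all_analysis.
From mathcomp Require Import ring lra.

Set Implicit Arguments.
Unset Strict Implicit.
Unset Printing Implicit Defensive.

Import Order.TTheory GRing.Theory Num.Theory.

Local Open Scope classical_set_scope.
Local Open Scope ring_scope.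

(** Write A = I_L a I_L and, for f with values in [0, 1], Q_f = I_(1-f) + I_f A.

    Reduction to L = X. If all f_i are supported in L, then
    I_L b_(f_1) ... b_(f_m) I_L, with b_f the cleaning operators of a, acts on
    vectors as Q_(f_1) ... Q_(f_m) Q_(1 - 1_L): on vectors supported in L the
    operators b_f and Q_f agree, and Q_(1 - 1_L) = I_L because A maps into
    vectors supported in L ([act_restr_sweep]).  For a single h with support L
    the product Q_h Q_(1 - 1_L) is Q_(h + 1 - 1_L) ([act_restr_cleaning]).  So
    every condition speaks of P = Q_(f_1) ... Q_(f_m) for functions f_i on the
    whole of X, whose sum is bounded below, or (for a single one) positive,
    everywhere.

    Comparison of potentials. Let G_M w = sum_k M^k w, the least solution of
    g >= w + M g.  Since the conditions say that c G_M w is finite, it suffices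
    to bound one potential by a multiple of another, at every point.

    - From (a) to (c): g = G_A w satisfies g = f w + Q_f g for each f.  Peeling
      off the factors of P one by one gives
      g >= (1 - prod_i (1 - f_i)) w + P g, and 1 - prod_i (1 - f_i) is at least
      some d > 0 because it dominates each f_i.  So g / d is a supersolution
      for P, whence G_P w <= G_A w / d ([pot_sweep_le]).
    - From (b') to (a): if h > 0, then g = G_(Q_h) w satisfies
      h g = w + h A g wherever it is finite, hence g >= w + A g, and
      G_A w <= g ([pot_le_cleaning]).
    - From (c') to (a): formally 1 - P = F (1 - A) with
      F = f_1 + Q_(f_1) f_2 + Q_(f_1) Q_(f_2) f_3 + ..., so that
      G_A = G_P F.  The subtraction-free form F A + 1 = F + P
      ([swept_identity]) makes this rigorous, by telescoping over the powers of
      A, wherever G_P w is finite ([pot_le_swept]).  The bound A w <= C w gives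
      F w <= D w, and then G_A w <= D G_P w ([pot_le_sweep]).

    The implications from (c) to (b) and (c'), and from (b) to (b'), are
    specializations, to m = 1 and to the indicator function of L. *)

(** * Sums of nonnegative extended reals *)

Section NonnegativeSums.
Local Open Scope ereal_scope.
Context {R : realType}.

Lemma exchange_esum (I J : choiceType) (a : I -> J -> \bar R) :
  (forall i j, 0 <= a i j) ->
  \esum_(i in [set: I]) \esum_(j in [set: J]) a i j =
  \esum_(j in [set: J]) \esum_(i in [set: I]) a i j.
Proof.
move=> a0; rewrite !esum_esum//.
rewrite (reindex_esum ([set: I] `*`` (fun=> [set: J])) _
  (fun k : I * J => (k.2, k.1)))//=.
split=> [[i j]//|[i j] [i' j'] _ _ /= [-> ->]//|[j i] _ /=].
by exists (i, j).
Qed.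

Lemma le_esumZl (I : choiceType) (k : \bar R) (a : I -> \bar R) :
  0 <= k -> (forall i, 0 <= a i) ->
  \esum_(i in [set: I]) (k * a i) <= k * \esum_(i in [set: I]) a i.
Proof.
move=> k0 a0; apply: ge_ereal_sup => _ [D [finD _] <-].
have -> : (\sum_(i \in D) k * a i)%E = k * \sum_(i \in D) a i.
  by rewrite !fsbig_finite//= ge0_sume_distrr.
by apply: lee_wpmul2l => //; apply: ereal_sup_ubound; exists D.
Qed.

(** The factor k may be infinite, as products of real matrices may have infinite
    entries. *)
Lemma ge0_esumZl (I : choiceType) (k : \bar R) (a : I -> \bar R) :
  0 <= k -> (forall i, 0 <= a i) ->
  \esum_(i in [set: I]) (k * a i) = k * \esum_(i in [set: I]) a i.
Proof.
move=> k0 a0; apply/eqP; rewrite eq_le le_esumZl//=.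
have ka0 i : 0 <= k * a i by apply: mule_ge0.
case: k k0 ka0 => [k||//] k0 ka0.
  have [->|k_neq0] := eqVneq k 0%R; first by rewrite mul0e esum_ge0// => i _; apply: mule_ge0.
  have kgt0 : (0 < k)%R by rewrite lt_neqAle eq_sym k_neq0.
  rewrite -lee_pdivlMl//.
  rewrite (eq_esum (b := fun i => (k^-1)%:E * (k%:E * a i))); last first.
    by move=> i _; rewrite muleA -EFinM mulVf// mul1e.
  by apply: le_esumZl => //; rewrite lee_fin invr_ge0 ltW.
(* For k = +oo both sides are 0 or +oo, according to whether a vanishes. *)
have [a_eq0|/existsNP[i ai]] := pselect (forall i, a i = 0).
  by rewrite (@esum1 _ _ _ a)// mule0 esum_ge0.
have ai0 : 0 < a i by rewrite lt0e a0 andbT; apply/eqP.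
have -> : \esum_(i in [set: I]) (+oo * a i) = +oo; last by rewrite leey.
apply/eqP; rewrite -leye_eq; apply: esum_ge; exists [set i].
  by split=> //; exact: finite_set1.
by rewrite fsbig_set1 gt0_mulye.
Qed.

Lemma esum_delta (I : choiceType) (i : I) (a : I -> \bar R) :
  0 <= a i -> (forall j, j != i -> a j = 0) -> \esum_(j in [set: I]) a j = a i.
Proof.
move=> ai0 a0; rewrite -(esum_set1 ai0) [RHS]esum_mkcond.
apply: eq_esum => j _; case: ifPn => // /negP; rewrite inE => /eqP /a0 //.
Qed.

Lemma esum_nneseries (I : choiceType) (a : nat -> I -> \bar R) :
  (forall k i, 0 <= a k i) ->
  \esum_(i in [set: I]) \sum_(0 <= k <oo) a k i =
  \sum_(0 <= k <oo) \esum_(i in [set: I]) a k i.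
Proof.
move=> a0; rewrite nneseries_esumT; last by move=> k; apply: esum_ge0.
rewrite exchange_esum; last by [].
by apply: eq_esum => i _; rewrite nneseries_esumT.
Qed.

End NonnegativeSums.

(** * Nonnegative matrices acting on nonnegative vectors *)

Section MatrixAction.
Local Open Scope ereal_scope.
Context {R : realType} {X : countType}.
Implicit Types (A B : X -> X -> \bar R) (u v g : X -> \bar R) (f : X -> R).
Implicit Types (L : set X) (fs : seq (X -> R)).

Definition nonneg v : Prop := forall x, 0 <= v x.
Definition nonneg_mx A : Prop := forall x y, 0 <= A x y.

(** The counterpart of [imx_mulv] for vectors with values in [0, +oo]: the
    potentials to which matrices are applied below may be infinite. *)
Definition act A v : X -> \bar R :=
  fun x => \esum_(y in [set: X]) (A x y * v y).

Lemma act_ge0 A v : nonneg_mx A -> nonneg v -> nonneg (act A v).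
Proof. by move=> A0 v0 x; apply: esum_ge0 => y _; apply: mule_ge0. Qed.

Lemma act_le A u v : nonneg_mx A -> (forall x, u x <= v x) ->
  forall x, act A u x <= act A v x.
Proof. by move=> A0 uv x; apply: le_esum => y _; apply: lee_wpmul2l. Qed.

Lemma actD A u v : nonneg_mx A -> nonneg u -> nonneg v ->
  act A (fun x => u x + v x) = fun x => act A u x + act A v x.
Proof.
move=> A0 u0 v0; apply/funext => x; rewrite /act -esumD; first last.
- by move=> y _; apply: mule_ge0.
- by move=> y _; apply: mule_ge0.
by apply: eq_esum => y _; rewrite ge0_muleDr.
Qed.

Lemma actZ A (k : R) v : nonneg_mx A -> (0 <= k)%R -> nonneg v ->
  act A (fun x => k%:E * v x) = fun x => k%:E * act A v x.
Proof.
move=> A0 k0 v0; apply/funext => x; rewrite /act -ge0_esumZl//.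
- by apply: eq_esum => y _; rewrite muleCA.
- by move=> y; apply: mule_ge0.
Qed.

Lemma act_nneseries A (v : nat -> X -> \bar R) : nonneg_mx A ->
  (forall k, nonneg (v k)) ->
  act A (fun x => \sum_(0 <= k <oo) v k x) =
  fun x => \sum_(0 <= k <oo) act A (v k) x.
Proof.
move=> A0 v0; apply/funext => x; rewrite /act -esum_nneseries; last first.
  by move=> k y; apply: mule_ge0 => //; apply: v0.
apply: eq_esum => y _; rewrite !nneseries_esumT ?ge0_esumZl//.
- by move=> k; apply: v0.
- by move=> k; apply: mule_ge0 => //; apply: v0.
- by move=> k; apply: v0.
Qed.

Lemma act_mul A B v : nonneg_mx A -> nonneg_mx B -> nonneg v ->
  act (imx_mul A B) v = act A (act B v).
Proof.
move=> A0 B0 v0; apply/funext => x; rewrite /act /imx_mul.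
transitivity (\esum_(z in [set: X]) \esum_(y in [set: X]) (A x y * (B y z * v z))).
  apply: eq_esum => z _; rewrite muleC -ge0_esumZl//; last first.
    by move=> y; apply: mule_ge0.
  by apply: eq_esum => y _; rewrite muleC muleA.
rewrite exchange_esum; last by move=> z y; rewrite !mule_ge0.
by apply: eq_esum => y _; rewrite ge0_esumZl// => z; apply: mule_ge0.
Qed.

Lemma imx_mul_ge0 A B : nonneg_mx A -> nonneg_mx B -> nonneg_mx (imx_mul A B).
Proof. by move=> A0 B0 x z; apply: esum_ge0 => y _; apply: mule_ge0. Qed.

Lemma imx_diag_ge0 f : (forall x, 0 <= f x)%R -> nonneg_mx (imx_diag f).
Proof. by move=> f0 x y; rewrite lee_fin mulrn_wge0. Qed.

Lemma act_diag f v : (forall x, 0 <= f x)%R -> nonneg v ->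
  act (imx_diag f) v = fun x => (f x)%:E * v x.
Proof.
move=> f0 v0; apply/funext => x; rewrite /act (@esum_delta _ _ x).
- by rewrite /imx_diag eqxx.
- by apply: mule_ge0 => //; exact: imx_diag_ge0.
- by move=> y yx; rewrite /imx_diag eq_sym (negbTE yx) mulr0n mul0e.
Qed.

Lemma imx_idE : @imx_id R X = imx_diag (fun=> 1%R).
Proof. by []. Qed.

Lemma act_id v : nonneg v -> act imx_id v = v.
Proof.
by move=> v0; rewrite imx_idE act_diag//; apply/funext => x; rewrite mul1e.
Qed.

Lemma act_add A B v : nonneg_mx A -> nonneg_mx B -> nonneg v ->
  act (imx_add A B) v = fun x => act A v x + act B v x.
Proof.
move=> A0 B0 v0; apply/funext => x; rewrite /act -esumD; first last.
- by move=> y _; apply: mule_ge0.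
- by move=> y _; apply: mule_ge0.
by apply: eq_esum => y _; rewrite ge0_muleDl.
Qed.

Lemma act_exp A k v : nonneg_mx A -> nonneg v ->
  nonneg_mx (imx_exp A k) /\ act (imx_exp A k) v = iter k (act A) v.
Proof.
move=> A0 v0; elim: k => [|k [E0 IH]] /=.
  by rewrite act_id//; split=> // x y; rewrite imx_idE; apply: imx_diag_ge0.
split; first exact: imx_mul_ge0.
by rewrite act_mul// IH.
Qed.

Lemma indic_ge0 L x : (0 <= \1_L x :> R)%R.
Proof. by rewrite indicE. Qed.

Lemma imx_restr_ge0 L A : nonneg_mx A -> nonneg_mx (imx_restr L A).
Proof.
have ? := imx_diag_ge0 (indic_ge0 L).
by move=> A0; do 2?apply: imx_mul_ge0.
Qed.

Lemma act_restr L A v : nonneg_mx A -> nonneg v ->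
  act (imx_restr L A) v =
  fun x => (\1_L x)%:E * act A (fun y => (\1_L y)%:E * v y) x.
Proof.
move=> A0 v0; have L0 := imx_diag_ge0 (indic_ge0 L).
rewrite /imx_restr !act_mul//; last exact: imx_mul_ge0.
rewrite !act_diag//; try exact: indic_ge0.
by apply: act_ge0 => // x; apply: mule_ge0 => //; rewrite lee_fin indic_ge0.
Qed.

End MatrixAction.

(** * Potentials *)

Section Potentials.
Local Open Scope ereal_scope.
Context {R : realType} {X : countType}.
Implicit Types (A B : X -> X -> \bar R) (u v g : X -> \bar R).

(** The potential (1 + A + A^2 + ...) v. *)
Definition pot A v : X -> \bar R :=
  fun x => \sum_(0 <= k <oo) iter k (act A) v x.

Lemma iter_act_ge0 A k v : nonneg_mx A -> nonneg v ->
  nonneg (iter k (act A) v).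
Proof. by move=> A0 v0; elim: k => //= k; apply: act_ge0. Qed.

Lemma pot_ge0 A v : nonneg_mx A -> nonneg v -> nonneg (pot A v).
Proof. by move=> A0 v0 x; apply: nneseries_ge0 => k _ _; apply: iter_act_ge0. Qed.

Lemma series_recl (a : nat -> \bar R) : (forall k, 0 <= a k) ->
  \sum_(0 <= k <oo) a k = a 0%N + \sum_(0 <= k <oo) a k.+1.
Proof.
move=> a0; rewrite nneseries_recl// -(nneseries_addn (f := a))//.
by congr (_ + _); apply: eq_eseriesr => k _; rewrite addn1.
Qed.

Lemma pot_fixed A v : nonneg_mx A -> nonneg v ->
  forall x, pot A v x = v x + act A (pot A v) x.
Proof.
move=> A0 v0 x; have i0 := iter_act_ge0 _ A0 v0.
rewrite {1}/pot series_recl; last by move=> k; apply: i0.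
by rewrite /= /pot act_nneseries// => k; apply: i0.
Qed.

Lemma pot_shift A v : nonneg_mx A -> nonneg v ->
  forall x, pot A v x = v x + pot A (act A v) x.
Proof.
move=> A0 v0 x; rewrite {1}/pot series_recl; last by move=> k; apply: iter_act_ge0.
by congr (_ + _); apply: eq_eseriesr => k _; rewrite iterSr.
Qed.

(** Supersolutions dominate the potential: they dominate each partial sum S_n,
    since S_(n+1) = v + A S_n. *)
Lemma pot_least A v g : nonneg_mx A -> nonneg v -> nonneg g ->
  (forall x, v x + act A g x <= g x) -> forall x, pot A v x <= g x.
Proof.
move=> A0 v0 g0 vg x.
have i0 := iter_act_ge0 _ A0 v0.
have part n y : \sum_(0 <= k < n) iter k (act A) v y <= g y.
  elim: n y => [|n IH] y; first by rewrite big_nil.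
  apply: le_trans (vg y); rewrite big_nat_recl//= leeD2l//.
  suff -> : \sum_(0 <= i < n) act A (iter i (act A) v) y =
            act A (fun z => \sum_(0 <= k < n) iter k (act A) v z) y.
    exact: act_le.
  rewrite /act -esum_sum; last first.
    by move=> z i _ _; apply: mule_ge0 => //; apply: i0.
  by apply: eq_esum => z _; rewrite ge0_sume_distrr// => i _; apply: i0.
apply: lime_le; last by apply: nearW => n; exact: part.
by apply: is_cvg_nneseries => k _ _; apply: i0.
Qed.

Lemma pot_le A u v : nonneg_mx A -> nonneg u -> (forall x, u x <= v x) ->
  forall x, pot A u x <= pot A v x.
Proof.
move=> A0 u0 uv x; apply: lee_nneseries => [k _ _|k _].
  exact: iter_act_ge0.
by elim: k x => //= k IH x; apply: act_le.
Qed.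

Lemma potD A u v : nonneg_mx A -> nonneg u -> nonneg v ->
  forall x, pot A (fun y => u y + v y) x = pot A u x + pot A v x.
Proof.
move=> A0 u0 v0 x.
rewrite -nneseriesD; try by move=> k _ _; apply: iter_act_ge0.
apply: eq_eseriesr => k _.
suff -> : iter k (act A) (fun y => u y + v y) =
  fun y => iter k (act A) u y + iter k (act A) v y by [].
elim: k => //= k ->; apply: actD => //; exact: iter_act_ge0.
Qed.

Lemma potZ A (k : R) v : nonneg_mx A -> (0 <= k)%R -> nonneg v ->
  forall x, pot A (fun y => k%:E * v y) x = k%:E * pot A v x.
Proof.
move=> A0 k0 v0 x.
rewrite -nneseriesZl; last by move=> n _; apply: iter_act_ge0.
apply: eq_eseriesr => n _.
suff -> : iter n (act A) (fun y => k%:E * v y) =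
  fun y => k%:E * iter n (act A) v y by [].
elim: n => //= n ->; apply: actZ => //; exact: iter_act_ge0.
Qed.

(** Only the action on nonnegative vectors matters, so a matrix may be replaced by
    another one without comparing entries. *)
Lemma eq_pot A B v : nonneg_mx B -> nonneg v ->
  (forall u, nonneg u -> act A u = act B u) -> pot A v = pot B v.
Proof.
move=> B0 v0 AB; apply/funext => x; apply: eq_eseriesr => k _.
suff -> : iter k (act A) v = iter k (act B) v by [].
by elim: k => //= k ->; apply: AB; apply: iter_act_ge0.
Qed.

(** By monotone convergence, summability of the powers is finiteness of the
    pairing of c with a potential; this makes pointwise comparison of potentials
    the common tool for all the implications. *)
Lemma summable_powers_pot (L : set X) (c w : X -> R) B :
  (forall x, 0 <= c x)%R -> (forall x, 0 <= w x)%R -> nonneg_mx B ->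
  summable_powers L c w B <->
  \esum_(x in [set: X]) ((c x)%:E * pot (imx_restr L B) (EFin \o w) x) < +oo.
Proof.
move=> c0 w0 B0; have r0 := imx_restr_ge0 L B0.
have w0' : nonneg (EFin \o w) by move=> x; rewrite lee_fin.
rewrite /summable_powers.
suff -> : \sum_(0 <= k <oo) imx_form c (imx_exp (imx_restr L B) k) w =
  \esum_(x in [set: X]) ((c x)%:E * pot (imx_restr L B) (EFin \o w) x) by [].
transitivity (\sum_(0 <= k <oo) \esum_(x in [set: X])
  ((c x)%:E * iter k (act (imx_restr L B)) (EFin \o w) x)).
  apply: eq_eseriesr => k _; apply: eq_esum => x _.
  by have [_ <-] := act_exp k r0 w0'.
have i0 k x : 0 <= iter k (act (imx_restr L B)) (EFin \o w) x.
  exact: iter_act_ge0.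
rewrite -esum_nneseries; last by move=> k x; rewrite mule_ge0// lee_fin.
by apply: eq_esum => x _; rewrite nneseriesZl.
Qed.

End Potentials.

(** * Products of cleaning operators *)

Section Cleaning.
Local Open Scope ereal_scope.
Context {R : realType} {X : countType}.
Implicit Types (A B : X -> X -> \bar R) (u v g : X -> \bar R) (f h : X -> R).
Implicit Types (L : set X) (fs : seq (X -> R)).

(** The cleaning operator of an extended-real matrix: A will be I_L a I_L, whose
    entries are products of matrices, while [cleaning a] is convertible to
    [cleaning_mx (imx_of a)]. *)
Definition cleaning_mx A f : X -> X -> \bar R :=
  imx_add (imx_diag (fun x => 1 - f x)%R) (imx_mul (imx_diag f) A).

Definition sweep_mx A fs : X -> X -> \bar R :=
  \big[imx_mul/imx_id]_(f <- fs) cleaning_mx A f.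

Lemma cleaning_mx_ge0 A f : nonneg_mx A -> unit_valued f ->
  nonneg_mx (cleaning_mx A f).
Proof.
move=> A0 f01 x y; apply: adde_ge0.
  by apply: imx_diag_ge0 => z; rewrite subr_ge0; case/andP: (f01 z).
by apply: imx_mul_ge0 => //; apply: imx_diag_ge0 => z; case/andP: (f01 z).
Qed.

Lemma act_cleaning A f v : nonneg_mx A -> unit_valued f -> nonneg v ->
  act (cleaning_mx A f) v =
  fun x => (1 - f x)%:E * v x + (f x)%:E * act A v x.
Proof.
move=> A0 f01 v0.
have f0 x : (0 <= f x)%R by case/andP: (f01 x).
have f1 x : (0 <= 1 - f x)%R by rewrite subr_ge0; case/andP: (f01 x).
rewrite act_add//; try exact: imx_diag_ge0; last first.
  by apply: imx_mul_ge0 => //; apply: imx_diag_ge0.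
by rewrite act_mul ?act_diag//; [exact: act_ge0|exact: imx_diag_ge0].
Qed.

Definition all_unit_valued fs := all (fun f => `[< unit_valued f >]) fs.

Lemma sweep_mx_ge0 A fs : nonneg_mx A -> all_unit_valued fs ->
  nonneg_mx (sweep_mx A fs).
Proof.
move=> A0; rewrite /sweep_mx; elim: fs => [|f fs IH] /=.
  by move=> _; rewrite big_nil imx_idE; apply: imx_diag_ge0.
move=> /andP[/asboolP f01 fs01]; rewrite big_cons.
by apply: imx_mul_ge0; [exact: cleaning_mx_ge0|exact: IH].
Qed.

Lemma act_sweep_cons A f fs v : nonneg_mx A -> unit_valued f ->
  all_unit_valued fs -> nonneg v ->
  act (sweep_mx A (f :: fs)) v = act (cleaning_mx A f) (act (sweep_mx A fs) v).
Proof.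
move=> A0 f01 fs01 v0; rewrite {1}/sweep_mx big_cons act_mul//.
  exact: cleaning_mx_ge0.
exact: sweep_mx_ge0.
Qed.

Lemma act_sweep_nil A v : nonneg v -> act (sweep_mx A [::]) v = v.
Proof. by move=> v0; rewrite /sweep_mx big_nil act_id. Qed.

Lemma act_sweep_rcons A f fs v : nonneg_mx A -> unit_valued f ->
  all_unit_valued fs -> nonneg v ->
  act (sweep_mx A (rcons fs f)) v = act (sweep_mx A fs) (act (cleaning_mx A f) v).
Proof.
move=> A0 f01 + v0; have c0 := cleaning_mx_ge0 A0 f01.
have cv0 := act_ge0 c0 v0.
elim: fs => [|e fs IH] /=; first by rewrite act_sweep_cons// !act_sweep_nil.
move=> /andP[/asboolP e01 fs01]; rewrite !act_sweep_cons// ?IH//.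
by rewrite /all_unit_valued all_rcons; apply/andP; split; first exact/asboolP.
Qed.

Definition outside L : X -> R := (fun x => 1 - \1_L x)%R.

Lemma outside_unit_valued L : unit_valued (outside L).
Proof.
by move=> x; rewrite /outside indicE; case: (x \in L) => /=;
   rewrite ?subrr ?subr0 lexx ler01.
Qed.

(** The cut-off I_L is itself a cleaning operator of I_L A I_L: outside L, where
    the function 1 - 1_L equals 1, cleaning replaces v by I_L A I_L v, that is
    by 0. *)
Lemma act_clean_outside L A v : nonneg_mx A -> nonneg v ->
  act (cleaning_mx (imx_restr L A) (outside L)) v =
  fun x => (\1_L x)%:E * v x.
Proof.
move=> A0 v0; rewrite act_cleaning//; [|exact: imx_restr_ge0|exact: outside_unit_valued].
rewrite act_restr//; apply/funext => x; rewrite /outside opprB addrCA subrr addr0.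
rewrite indicE; case: (x \in L) => /=.
  by rewrite subrr mul0e adde0.
by rewrite !mul0e mule0 adde0.
Qed.

(** Compression to L turns a product of cleaning operators of A into a product of
    cleaning operators of I_L A I_L, with the cut-off as last factor.  The
    cut-off on the left may be dropped because cleaning with functions
    supported in L keeps vectors supported in L, and on such vectors A may be
    replaced by I_L A I_L. *)
Lemma act_restr_sweep L A fs v : nonneg_mx A -> all_unit_valued fs ->
  all (fun f => `[< supp f `<=` L >]) fs -> nonneg v ->
  act (imx_restr L (sweep_mx A fs)) v =
  act (sweep_mx (imx_restr L A) (rcons fs (outside L))) v.
Proof.
move=> A0 fs01 fsL v0; have r0 := imx_restr_ge0 L A0.
rewrite act_restr//; last exact: sweep_mx_ge0.
rewrite act_sweep_rcons//; last exact: outside_unit_valued.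
rewrite act_clean_outside//.
set u := (fun y => (\1_L y)%:E * v y).
have u0 : nonneg u by move=> y; apply: mule_ge0 => //; rewrite lee_fin indic_ge0.
have Lu : u = (fun y => (\1_L y)%:E * u y).
  apply/funext => y; rewrite /u muleA -EFinM indicE.
  by case: (y \in L); rewrite ?mulr1 ?mulr0.
(* The second conjunct, that the vector stays supported in L, is what carries the
   first one through the induction. *)
suff [<- e] : act (sweep_mx A fs) u = act (sweep_mx (imx_restr L A) fs) u /\
    act (sweep_mx A fs) u = (fun x => (\1_L x)%:E * act (sweep_mx A fs) u x).
  by rewrite -e.
elim: fs fs01 fsL => [|f fs IH] /=; first by rewrite !act_sweep_nil.
move=> /andP[/asboolP f01 fs01] /andP[/asboolP fL fsL].
have [e1 e2] := IH fs01 fsL.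
rewrite (act_sweep_cons A0 f01 fs01 u0) (act_sweep_cons r0 f01 fs01 u0) -e1.
set g := act (sweep_mx A fs) u in e2 *.
have g0 : nonneg g by apply: act_ge0 => //; apply: sweep_mx_ge0.
rewrite !act_cleaning// act_restr// -e2.
have f_off x : x \notin L -> f x = 0%R.
  by move=> xL; apply: contraNeq xL => /fL; rewrite inE.
split; apply/funext => x; rewrite ?indicE.
  case: (boolP (x \in L)) => [xL|/f_off->]; last by rewrite !mul0e.
  by rewrite mul1e.
case: (boolP (x \in L)) => [xL|xL]; first by rewrite mul1e.
by rewrite f_off// mul0e [in LHS]e2 indicE (negbTE xL) !mul0e mule0 adde0.
Qed.

Lemma convex_split (t : R) (y : \bar R) : (0 <= t <= 1)%R -> 0 <= y ->
  (1 - t)%:E * y + t%:E * y = y.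
Proof.
move=> /andP[t0 t1] y0; rewrite -ge0_muleDl ?lee_fin ?subr_ge0//.
by rewrite -EFinD subrK mul1e.
Qed.

(** If each step catches the fraction f x of what is left at x, this is the
    fraction caught altogether. *)
Definition caught fs (x : X) : R := (1 - \prod_(f <- fs) (1 - f x))%R.

Lemma caught_cons f fs x :
  caught (f :: fs) x = (f x + (1 - f x) * caught fs x)%R.
Proof. by rewrite /caught big_cons; ring. Qed.

Lemma caught_itv fs x : all_unit_valued fs -> (0 <= caught fs x <= 1)%R.
Proof.
elim: fs => [|f fs IH] /=; first by rewrite /caught big_nil subrr lexx ler01.
move=> /andP[/asboolP /(_ x)/andP[f0 f1] /IH/andP[c0 c1]].
rewrite caught_cons; apply/andP; split; nra.
Qed.

(** The caught fraction dominates each single f x, hence their average. *)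
Lemma sum_le_caught fs x : all_unit_valued fs ->
  (\sum_(f <- fs) f x <= (size fs)%:R * caught fs x)%R.
Proof.
elim: fs => [|f fs IH] /=; first by rewrite big_nil mul0r.
move=> /andP[/asboolP /(_ x)/andP[f0 f1] fs01].
have /andP[c0 c1] := caught_itv x fs01.
have {IH} := IH fs01; rewrite big_cons -natr1 caught_cons.
have : (0 <= (size fs)%:R * (f x * (1 - caught fs x)))%R.
  by rewrite !mulr_ge0// subr_ge0.
nra.
Qed.

(** Each factor satisfies g = f v + Q_f g.  Inserting the bound for the remaining
    factors into Q_f g, and keeping only the part (1 - f) (...) of Q_f applied to
    the caught part of v, adds up the coefficients of v to
    f + (1 - f) (1 - prod (1 - f_i)). *)
Lemma fixed_point_sweep_le A fs v g : nonneg_mx A -> all_unit_valued fs ->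
  nonneg v -> nonneg g -> (forall x, g x = v x + act A g x) ->
  forall x, (caught fs x)%:E * v x + act (sweep_mx A fs) g x <= g x.
Proof.
move=> A0 + v0 g0 gE; elim: fs => [|f fs IH] /=.
  by move=> _ x; rewrite act_sweep_nil// /caught big_nil subrr mul0e add0e.
move=> /andP[/asboolP f01 fs01] x; have {}IH := IH fs01.
have S0 : nonneg (act (sweep_mx A fs) g) by apply/act_ge0/g0/sweep_mx_ge0.
rewrite act_sweep_cons// act_cleaning//.
set S := act (sweep_mx A fs) g in IH S0 *.
have c0 y : 0 <= (caught fs y)%:E by rewrite lee_fin; case/andP: (caught_itv y fs01).
have Sg y : S y <= g y.
  by apply: le_trans (IH y); rewrite leeDr// mule_ge0.
have /andP[fx0 fx1] := f01 x; have fx1' : (0 <= 1 - f x)%R by rewrite subr_ge0.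
rewrite caught_cons EFinD EFinM ge0_muleDl//; last by rewrite mule_ge0.
rewrite -[leRHS](convex_split (f01 x) (g0 x)) [X in _ <= _ + _ * X]gE.
rewrite ge0_muleDr//; last exact: act_ge0.
rewrite [leLHS](_ : _ = (1 - f x)%:E * ((caught fs x)%:E * v x + S x) +
  ((f x)%:E * v x + (f x)%:E * act A S x)).
  apply: leeD; first by apply: lee_wpmul2l.
  by apply: leeD2l; apply: lee_wpmul2l => //; apply: act_le.
rewrite ge0_muleDr//; last by rewrite mule_ge0.
by rewrite muleA [X in X + _ = _]addeC addeACA.
Qed.

(** The potential g of A, divided by d, is a supersolution for the product. *)
Lemma pot_sweep_le A fs v (d : R) : nonneg_mx A -> all_unit_valued fs ->
  nonneg v -> (0 < d)%R -> (forall x, d <= caught fs x)%R ->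
  forall x, pot (sweep_mx A fs) v x <= (d^-1)%:E * pot A v x.
Proof.
move=> A0 fs01 v0 d0 dc; have P0 := sweep_mx_ge0 A0 fs01.
have g0 := pot_ge0 A0 v0; have di0 : (0 <= d^-1)%R by rewrite invr_ge0 ltW.
have di0' : 0 <= (d^-1)%:E by rewrite lee_fin.
apply: pot_least => //; first by move=> x; rewrite mule_ge0.
move=> x; rewrite actZ//.
apply: le_trans (lee_wpmul2l di0' (fixed_point_sweep_le A0 fs01 v0 g0 (pot_fixed A0 v0) x)).
rewrite ge0_muleDr//; last first.
- exact: act_ge0.
- by rewrite mule_ge0// lee_fin; case/andP: (caught_itv x fs01).
apply: leeD2r; rewrite muleA -EFinM -[leLHS]mul1e; apply: lee_wpmul2r => //.
by rewrite lee_fin mulrC ler_pdivlMr// mul1r.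
Qed.

(** The potential g of Q_h satisfies g = v + (1 - h) g + h A g.  Where g is
    finite, h g = v + h A g, and dividing by h (at most 1, and positive) gives
    g >= v + A g; where g is infinite this is trivial. *)
Lemma pot_le_cleaning A h v : nonneg_mx A -> unit_valued h ->
  (forall x, 0 < h x)%R -> nonneg v ->
  forall x, pot A v x <= pot (cleaning_mx A h) v x.
Proof.
move=> A0 h01 h0 v0; have Q0 := cleaning_mx_ge0 A0 h01.
have g0 := pot_ge0 Q0 v0.
apply: pot_least => // x; have := pot_fixed Q0 v0 x.
rewrite act_cleaning//; have := act_ge0 A0 g0 x; have := g0 x; have := v0 x.
have := h0 x; have /andP[_] := h01 x.
case: (pot (cleaning_mx A h) v x) => [g||]; last 2 first.
- by move=> *; exact: leey.
- by move=> _ _ _; rewrite leeNy_eq.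
case: (act _ _ _) => [u||]; last 2 first.
(* If A g is infinite then so is g, as h > 0. *)
- by move=> _ hx; rewrite gt0_muley// -EFinM; case: (v x).
- by move=> _ _ _ _; rewrite leeNy_eq.
case: (v x) => [w||]; last 2 first.
- by rewrite -!EFinM -EFinD.
- by move=> _ _; rewrite leeNy_eq.
rewrite !lee_fin -!EFinM -!EFinD => h1 hx w1 g1 u1 [e].
nra.
Qed.

(** The vector F v, where F = f_1 + Q_(f_1) f_2 + Q_(f_1) Q_(f_2) f_3 + ... is
    the formal quotient of 1 - Q_(f_1) ... Q_(f_m) by 1 - A. *)
Fixpoint swept A fs v : X -> \bar R :=
  if fs is f :: fs' then
    fun x => (f x)%:E * v x + act (cleaning_mx A f) (swept A fs' v) x
  else fun=> 0.

Lemma swept_ge0 A fs v : nonneg_mx A -> all_unit_valued fs -> nonneg v ->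
  nonneg (swept A fs v).
Proof.
move=> A0 + v0; elim: fs => [|f fs IH] /=; first by move=> _ x.
move=> /andP[/asboolP f01 fs01] x; apply: adde_ge0; first by rewrite mule_ge0// lee_fin; case/andP: (f01 x).
by apply: act_ge0; [exact: cleaning_mx_ge0|exact: IH].
Qed.

(** The equation F (1 - A) = 1 - P without subtraction.  It is the telescoping sum
    of the equations f A + 1 = f + Q_f, multiplied on the left by the preceding
    factors. *)
Lemma swept_identity A fs v : nonneg_mx A -> all_unit_valued fs -> nonneg v ->
  forall x, swept A fs (act A v) x + v x =
            swept A fs v x + act (sweep_mx A fs) v x.
Proof.
move=> A0 + v0; have Av0 := act_ge0 A0 v0.
elim: fs => [|f fs IH] /=; first by move=> _ x; rewrite act_sweep_nil.
move=> /andP[/asboolP f01 fs01] x; have {}IH := IH fs01.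
have Q0 := cleaning_mx_ge0 A0 f01; have P0 := sweep_mx_ge0 A0 fs01.
have [F0 FA0] := (swept_ge0 A0 fs01 v0, swept_ge0 A0 fs01 Av0).
have Pv0 := act_ge0 P0 v0.
rewrite act_sweep_cons// -[RHS]addeA.
have <- := congr1 (@^~ x) (actD Q0 F0 Pv0).
rewrite (_ : (fun y => _) = fun y => swept A fs (act A v) y + v y); last first.
  by apply/funext => y; rewrite IH.
rewrite actD// -[in LHS](convex_split (f01 x) (v0 x)).
rewrite (act_cleaning A0 f01 v0) /=.
rewrite addeA [LHS]addeC; congr (_ + _).
by rewrite -addeA addeC -addeA.
Qed.

(** Each Q_f multiplies the bound on a vector by at most 1 + C. *)
Lemma swept_le A fs v (C : R) : nonneg_mx A -> all_unit_valued fs ->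
  nonneg v -> (0 <= C)%R -> (forall x, act A v x <= C%:E * v x) ->
  exists2 D : R, (0 < D)%R & forall x, swept A fs v x <= D%:E * v x.
Proof.
move=> A0 + v0 C0 AC; elim: fs => [_|f fs IH] /=.
  by exists 1%R => // x; rewrite mul1e.
move=> /andP[/asboolP f01 fs01]; have [D D0 FD] := IH fs01.
have Q0 := cleaning_mx_ge0 A0 f01.
exists (1 + D * (1 + C))%R => [|x].
  by rewrite ltr_pwDl// mulr_ge0 ?addr_ge0// ltW.
have /andP[fx0 fx1] := f01 x.
have D0' := ltW D0.
have D10 : (0 <= D * (1 + C))%R by rewrite mulr_ge0 ?addr_ge0.
rewrite EFinD ge0_muleDl ?lee_fin// mul1e; apply: leeD.
  by rewrite -[leRHS]mul1e; apply: lee_wpmul2r => //; rewrite lee_fin.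
apply: (le_trans (act_le Q0 FD x)); rewrite actZ// act_cleaning// EFinM -muleA.
apply: lee_wpmul2l; first by rewrite lee_fin.
rewrite (EFinD 1 C) (ge0_muleDl (v x)) ?lee_fin// mul1e; apply: leeD.
  rewrite -[leRHS]mul1e; apply: lee_wpmul2r => //.
  by rewrite lee_fin gerBl.
apply: le_trans (AC x); rewrite -[leRHS]mul1e.
by apply: lee_wpmul2r; [exact: act_ge0|rewrite lee_fin].
Qed.

(** Applying G_P to F A u + u = F u + P u, and subtracting the finite number
    (G_P P u)(x) from both sides, gives (G_P F u)(x) = u(x) + (G_P F A u)(x);
    iterating this with u = v, A v, A^2 v, ... bounds the partial sums of the
    potential of A.  The domination A v <= C v is what keeps (G_P P u)(x) finite
    for these u. *)
Lemma pot_le_swept A fs v (C : R) x : nonneg_mx A -> all_unit_valued fs ->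
  nonneg v -> (0 <= C)%R -> (forall y, act A v y <= C%:E * v y) ->
  pot (sweep_mx A fs) v x < +oo ->
  pot A v x <= pot (sweep_mx A fs) (swept A fs v) x.
Proof.
move=> A0 fs01 v0 C0 AC fin; have P0 := sweep_mx_ge0 A0 fs01.
set P := sweep_mx A fs in P0 fin *.
have step u (K : R) : (0 <= K)%R -> nonneg u -> (forall y, u y <= K%:E * v y) ->
  u x + pot P (swept A fs (act A u)) x = pot P (swept A fs u) x.
  move=> K0 u0 uK; have Au0 := act_ge0 A0 u0; have Pu0 := act_ge0 P0 u0.
  have [F0 FA0] := (swept_ge0 A0 fs01 u0, swept_ge0 A0 fs01 Au0).
  have fin_Pu : pot P (act P u) x \is a fin_num.
    rewrite ge0_fin_numE; last exact: pot_ge0.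
    have : pot P u x < +oo.
      apply: le_lt_trans (pot_le P0 u0 uK x) _.
      by rewrite potZ// lte_mul_pinfty// lee_fin.
    rewrite pot_shift//; apply: le_lt_trans.
    by rewrite leeDr.
  have : pot P (fun y => swept A fs (act A u) y + u y) x =
         pot P (fun y => swept A fs u y + act P u y) x.
    by congr pot; apply/funext => y; apply: swept_identity.
  rewrite !potD// (pot_shift P0 u0) addeA => /(congr1 (fun z => z - pot P (act P u) x)).
  by rewrite !addeK// addeC.
have part n : forall u (K : R), (0 <= K)%R -> nonneg u ->
    (forall y, u y <= K%:E * v y) ->
    \sum_(0 <= k < n) iter k (act A) u x <= pot P (swept A fs u) x.
  elim: n => [|n IH] u K K0 u0 uK.
    by rewrite big_nil; apply: pot_ge0 => //; exact: swept_ge0.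
  rewrite big_nat_recl//= -(step u K)// leeD2l//.
  under eq_bigr do rewrite -iterS iterSr.
  apply: (IH _ (K * C)%R) => //; [exact: mulr_ge0|exact: act_ge0|] => y.
  apply: (le_trans (act_le A0 uK y)); rewrite actZ// EFinM -muleA.
  by apply: lee_wpmul2l.
apply: lime_le; last first.
  by apply: nearW => n; apply: (part n v 1%R) => // y; rewrite mul1e.
by apply: is_cvg_nneseries => k _ _; apply: iter_act_ge0.
Qed.

Lemma pot_le_sweep A fs v (C : R) : nonneg_mx A -> all_unit_valued fs ->
  nonneg v -> (0 <= C)%R -> (forall x, act A v x <= C%:E * v x) ->
  exists2 D : R, (0 < D)%R &
    forall x, pot A v x <= D%:E * pot (sweep_mx A fs) v x.
Proof.
move=> A0 fs01 v0 C0 AC; have [D D0 FD] := swept_le A0 fs01 v0 C0 AC.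
exists D => // x; have P0 := sweep_mx_ge0 A0 fs01.
have [fin|] := ltP (pot (sweep_mx A fs) v x) +oo; last first.
  by rewrite leye_eq => /eqP ->; rewrite gt0_muley ?leey.
apply: le_trans (pot_le_swept A0 fs01 v0 C0 AC fin) _.
by rewrite -potZ// ?(ltW D0)//; apply: pot_le => //; exact: swept_ge0.
Qed.

End Cleaning.

(** * The five conditions *)

Section Conditions.
Local Open Scope ereal_scope.
Context {R : realType} {X : countType}.
Implicit Types (L : set X) (c w h : X -> R) (a : X -> X -> R).

Lemma imx_mul_id (A : X -> X -> \bar R) : nonneg_mx A -> imx_mul A imx_id = A.
Proof.
move=> A0; apply/funext => x; apply/funext => z.
rewrite /imx_mul (@esum_delta _ _ z) /imx_id.
- by rewrite eqxx mule1.
- by rewrite eqxx mule1.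
- by move=> y /negbTE ->; rewrite mule0.
Qed.

Lemma imx_of_ge0 a : (forall x y, 0 <= a x y)%R -> nonneg_mx (imx_of a).
Proof. by move=> a0 x y; rewrite lee_fin. Qed.

Lemma cleaning_prod1 a h : (forall x y, 0 <= a x y)%R -> unit_valued h ->
  cleaning_prod a (fun _ : 'I_1 => h) = cleaning a h.
Proof.
move=> a0 h01; rewrite /cleaning_prod big_ord_recl big_ord0 imx_mul_id//.
by apply: cleaning_mx_ge0 => //; exact: imx_of_ge0.
Qed.

(** Sequences rather than families, so that the cut-off can be appended. *)
Definition family_seq m (f : 'I_m -> X -> R) : seq (X -> R) :=
  [seq f i | i <- index_enum 'I_m].

Lemma cleaning_prodE a m (f : 'I_m -> X -> R) :
  cleaning_prod a f = sweep_mx (imx_of a) (family_seq f).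
Proof. by rewrite /sweep_mx big_map. Qed.

Lemma all_family_seq m (f : 'I_m -> X -> R) (P : (X -> R) -> Prop) :
  (forall i, P (f i)) -> all (fun e => `[< P e >]) (family_seq f).
Proof. by move=> Pf; rewrite all_map; apply/allP => i _; apply/asboolP. Qed.

Lemma all_unit_valued_outside L fs : all_unit_valued fs ->
  all_unit_valued (rcons fs (outside L) : seq (X -> R)).
Proof.
move=> fs01; rewrite /all_unit_valued all_rcons; apply/andP; split=> //.
by apply/asboolP; exact: outside_unit_valued.
Qed.

Lemma indic_unit_valued L : unit_valued (\1_L : X -> R).
Proof. by move=> x; rewrite indicE; case: (_ \in _) => /=; rewrite lexx ler01. Qed.

Lemma supp_indic L : supp (\1_L : X -> R) = L.
Proof.
apply/seteqP; split=> x; rewrite /supp /= indicE.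
  by case: (boolP (x \in L)) => [/set_mem//|_]; rewrite eqxx.
by move=> /mem_set ->; rewrite oner_eq0.
Qed.

Lemma summable_powers_le L c w (A B : X -> X -> \bar R) (D : R) :
  (forall x, 0 <= c x)%R -> (forall x, 0 <= w x)%R -> (0 <= D)%R ->
  nonneg_mx A -> nonneg_mx B ->
  (forall x, pot (imx_restr L A) (EFin \o w) x <=
             D%:E * pot (imx_restr L B) (EFin \o w) x) ->
  summable_powers L c w B -> summable_powers L c w A.
Proof.
move=> c0 w0 D0 A0 B0 AB /(summable_powers_pot L c0 w0 B0) fin.
apply/(summable_powers_pot L c0 w0 A0).
have w0' : nonneg (EFin \o w) by move=> x; rewrite lee_fin.
have g0 := pot_ge0 (imx_restr_ge0 L B0) w0'.
apply: (@le_lt_trans _ _ (D%:E *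
  \esum_(x in [set: X]) ((c x)%:E * pot (imx_restr L B) (EFin \o w) x))).
  rewrite -ge0_esumZl//; last by move=> x; rewrite mule_ge0// lee_fin.
  by apply: le_esum => x _; rewrite muleCA; apply: lee_wpmul2l => //; rewrite lee_fin.
by rewrite lte_mul_pinfty// lee_fin.
Qed.

Lemma pot_restr_sweep L A fs (v : X -> \bar R) : nonneg_mx A ->
  all_unit_valued fs -> all (fun f => `[< supp f `<=` L >]) fs -> nonneg v ->
  pot (imx_restr L (sweep_mx A fs)) v =
  pot (sweep_mx (imx_restr L A) (rcons fs (outside L))) v.
Proof.
move=> A0 fs01 fsL v0; apply: eq_pot => // [|u u0].
  apply: sweep_mx_ge0; first exact: imx_restr_ge0.
  exact: all_unit_valued_outside.
exact: act_restr_sweep.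
Qed.

(** For one cleaning function with support L the cut-off is absorbed by the
    function h + (1 - 1_L), which is positive on all of X. *)
Lemma act_restr_cleaning L A h v : nonneg_mx A -> unit_valued h ->
  supp h = L -> nonneg v ->
  unit_valued (h + outside L)%R /\
  act (imx_restr L (cleaning_mx A h)) v =
  act (cleaning_mx (imx_restr L A) (h + outside L)%R) v.
Proof.
move=> A0 h01 hL v0.
have h_off x : x \notin L -> h x = 0%R.
  by rewrite -hL; apply: contraNeq => hx; rewrite inE.
have h'01 : unit_valued (h + outside L)%R.
  move=> x; rewrite fctE /outside indicE; case: (boolP (x \in L)) => [_|/h_off ->].
    by rewrite subrr addr0.
  by rewrite subr0 add0r ler01 lexx.
split=> //.
have u0 : nonneg (fun y => (\1_L y)%:E * v y).
  by move=> y; apply: mule_ge0 => //; rewrite lee_fin indic_ge0.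
rewrite act_restr//; last exact: cleaning_mx_ge0.
rewrite !act_cleaning//; last exact: imx_restr_ge0.
rewrite act_restr//; apply/funext => x; rewrite fctE /outside !indicE.
case: (boolP (x \in L)) => [_|/h_off ->] /=.
  by rewrite subrr addr0 !mul1e.
by rewrite !mul0e mule0 subr0 add0r subrr mul0e add0e.
Qed.

Lemma cond_a_c L c w a :
  (forall x, 0 <= c x)%R -> (forall x, 0 <= w x)%R -> (forall x y, 0 <= a x y)%R ->
  cond_a L c w a -> cond_c L c w a.
Proof.
move=> c0 w0 a0 Ha m f _ f01 fL [e e0 ef].
have A0 := imx_of_ge0 a0.
have w0' : nonneg (EFin \o w) by move=> x; rewrite lee_fin.
have fs01 : all_unit_valued (family_seq f) by exact: all_family_seq.
have fsL : all (fun f => `[< supp f `<=` L >]) (family_seq f).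
  exact: (all_family_seq (P := fun e => supp e `<=` L)).
have fs'01 := all_unit_valued_outside L fs01.
rewrite cleaning_prodE.
(* The minimum with 1 is for the points outside L, where the lower bound comes
   from the cut-off function, whose value there is 1. *)
pose e1 := Num.min e 1%R; have e10 : (0 < e1)%R by rewrite lt_min e0 ltr01.
pose n := size (rcons (family_seq f) (outside L)).
have n0 : (0 < n%:R :> R)%R by rewrite ltr0n /n size_rcons.
have dc x : (e1 / n%:R <= caught (rcons (family_seq f) (outside L)) x)%R.
  rewrite ler_pdivrMr// mulrC; apply: le_trans (sum_le_caught _ fs'01).
  rewrite big_rcons/= big_map addrC.
  have s0 : (0 <= \sum_(i < m) f i x)%R.
    by apply: sumr_ge0 => i _; case/andP: (f01 i x).
  move: (ef x); rewrite /outside indicE; case: (x \in L) => /=.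
    by rewrite mulr1 subrr add0r; apply: le_trans; rewrite ge_min lexx.
  by move=> _; rewrite subr0 ler_wpDr// ge_min lexx orbT.
have d0 := divr_gt0 e10 n0.
have D0 : (0 <= (e1 / n%:R)^-1)%R by rewrite invr_ge0 ltW.
apply: (summable_powers_le c0 w0 D0 _ A0 _ Ha); first exact: sweep_mx_ge0.
move=> x; rewrite pot_restr_sweep//.
exact: (pot_sweep_le (imx_restr_ge0 L A0) fs'01 w0' d0 dc x).
Qed.

Lemma cond_c_b L c w a : (forall x y, 0 <= a x y)%R ->
  cond_c L c w a -> cond_b L c w a.
Proof.
move=> a0 Hc h h01 hL [e e0 eh]; rewrite -cleaning_prod1//.
apply: Hc => // [_|]; first by rewrite hL.
by exists e => // x; rewrite big_ord1.
Qed.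

Lemma cond_b_b' L c w a : cond_b L c w a -> cond_b' L c w a.
Proof.
move=> Hb; exists \1_L; split; [exact: indic_unit_valued|exact: supp_indic|].
apply: Hb; [exact: indic_unit_valued|exact: supp_indic|].
by exists 1%R => // x; rewrite mul1r.
Qed.

Lemma cond_c_c' L c w a : cond_c L c w a -> cond_c' L c w a.
Proof.
move=> Hc; exists 1%N, (fun=> \1_L); split=> //.
- by move=> _; exact: indic_unit_valued.
- by move=> _; rewrite supp_indic.
apply: Hc => // [_|_|]; [exact: indic_unit_valued|by rewrite supp_indic|].
by exists 1%R => // x; rewrite mul1r big_ord1.
Qed.

Lemma cond_b'_a L c w a :
  (forall x, 0 <= c x)%R -> (forall x, 0 <= w x)%R -> (forall x y, 0 <= a x y)%R ->
  cond_b' L c w a -> cond_a L c w a.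
Proof.
move=> c0 w0 a0 [h [h01 hL Hh]].
have A0 := imx_of_ge0 a0; have r0 := imx_restr_ge0 L A0.
have w0' : nonneg (EFin \o w) by move=> x; rewrite lee_fin.
have [h'01 _] := act_restr_cleaning A0 h01 hL w0'.
have Q0 := cleaning_mx_ge0 r0 h'01.
have AB u := fun u0 : nonneg u => (act_restr_cleaning A0 h01 hL u0).2.
apply: (summable_powers_le c0 w0 ler01 A0 _ _ Hh); first exact: cleaning_mx_ge0.
move=> x; rewrite mul1e (eq_pot Q0 w0' AB).
apply: pot_le_cleaning => // y; rewrite fctE /outside indicE.
case: (boolP (y \in L)) => yL.
  rewrite subrr addr0 lt_neqAle eq_sym; have /andP[-> _] := h01 y.
  by rewrite andbT; move: yL; rewrite -hL inE.
by rewrite subr0 ltr_wpDl//; case/andP: (h01 y).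
Qed.

Lemma cond_c'_a L c w a (C : R) :
  (forall x, 0 <= c x)%R -> (forall x, 0 <= w x)%R -> (forall x y, 0 <= a x y)%R ->
  (forall x, imx_mulv (imx_restr L (imx_of a)) w x <= (C * w x)%:E) ->
  cond_c' L c w a -> cond_a L c w a.
Proof.
move=> c0 w0 a0 AC [m [f [_ f01 fL Hf]]].
have A0 := imx_of_ge0 a0; have r0 := imx_restr_ge0 L A0.
have w0' : nonneg (EFin \o w) by move=> x; rewrite lee_fin.
have fs01 : all_unit_valued (family_seq f) by exact: all_family_seq.
have fsL : all (fun f => `[< supp f `<=` L >]) (family_seq f).
  exact: (all_family_seq (P := fun e => supp e `<=` L)).
have fs'01 := all_unit_valued_outside L fs01.
(* C may be negative (when w = 0, say). *)
have C0 : (0 <= Num.max C 0)%R by rewrite le_max lexx orbT.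
have AC' x : act (imx_restr L (imx_of a)) (EFin \o w) x <=
    (Num.max C 0)%:E * (EFin \o w) x.
  apply: le_trans (AC x) _; rewrite -EFinM lee_fin ler_wpM2r//.
  by rewrite le_max lexx.
have [D D0 HD] := pot_le_sweep r0 fs'01 w0' C0 AC'.
move: Hf; rewrite cleaning_prodE.
apply: (summable_powers_le c0 w0 (ltW D0)) => //; first exact: sweep_mx_ge0.
by move=> x; rewrite pot_restr_sweep.
Qed.

End Conditions.

Theorem theorem3p27 (R : realType) (X : countType) (X_neq0 : [set: X] !=set0)
    (L : set X) (c w : X -> R)
    (c_ge0 : forall x, 0 <= c x) (w_ge0 : forall x, 0 <= w x)
    (c_gt0 : forall x, L x -> 0 < c x) (w_gt0 : forall x, L x -> 0 < w x)
    (a : X -> X -> R) (a_ge0 : forall x y, 0 <= a x y) :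
  [/\ [<-> cond_a L c w a; cond_b L c w a; cond_b' L c w a; cond_c L c w a],
      cond_a L c w a -> cond_c' L c w a &
      (exists C : R, forall x,
         (imx_mulv (imx_restr L (imx_of a)) w x <= (C * w x)%:E)%E) ->
      [<-> cond_a L c w a; cond_b L c w a; cond_b' L c w a; cond_c L c w a;
           cond_c' L c w a]].
Proof.
have a_c : cond_a L c w a -> cond_c L c w a by exact: cond_a_c.
have a_b : cond_a L c w a -> cond_b L c w a by move/a_c; exact: cond_c_b.
have b'_a : cond_b' L c w a -> cond_a L c w a by exact: cond_b'_a.
have c_a : cond_c L c w a -> cond_a L c w a.
  by move=> Hc; apply/b'_a/cond_b_b'/cond_c_b.
split.
- by tfae=> //; [exact: cond_b_b'|move/b'_a].
- by move/a_c; exact: cond_c_c'.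
- move=> [C AC]; tfae=> //; [exact: cond_b_b'|by move/b'_a|exact: cond_c_c'|].
  exact: cond_c'_a AC.
Qed.
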